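(* Let $X$ be a real Hilbert space and let $C := \{(x,y)\in X\times X : \langle x,y\rangle = 0\}$. Then $C$ is closed (in the norm topology of $X\times X$). If $X$ is finite-dimensional, then $C$ is proximinal. If $X$ is infinite-dimensional, then $C$ is neither weakly closed nor weakly sequentially closed; in fact, both the weak closure of $C$ and the weak sequential closure of $C$ are equal to $X\times X$.
   Context: $X\times X$ is the product Hilbert space with inner product $\langle (x,y),(u,v)\rangle=\langle x,u\rangle+\langle y,v\rangle$. A subset $S$ of a Hilbert space $H$ is proximinal if every point of $H$ has at least one nearest point in $S$. A set is weakly sequentially closed if it contains the weak limit of every weakly convergent sequence of its elements; the weak sequential closure of a set is the smallest weakly sequentially closed set containing it. *)

(* Defs.v *)
From HB Require Import structures.
From mathcomp Require Import all_boot all_order all_algebra sesquilinear.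
From mathcomp Require Import all_classical all_reals all_analysis.
From mathcomp Require Import ring lra.

Set Implicit Arguments.
Unset Strict Implicit.
Unset Printing Implicit Defensive.

Import Order.TTheory GRing.Theory Num.Theory.
Import numFieldNormedType.Exports.

Local Open Scope classical_set_scope.
Local Open Scope ring_scope.

HB.mixin Record CompleteNormedModule_isHilbert (R : realType) H
    & CompleteNormedModule R H := {
  inner : {dot H for @idfun R} ;
  innerxx : forall x : H, inner x x = `|x| ^+ 2
}.

#[short(type="hilbertType")]
HB.structure Definition Hilbert (R : realType) :=
  {H of CompleteNormedModule R H & CompleteNormedModule_isHilbert R H}.

(* The canonical norm on X * Y is the max norm, so the Hilbert product needs
   an alias. *)
Definition hprod (R : realType) (X Y : hilbertType R) : Type := (X * Y)%type.

Section HilbertProduct.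
Context (R : realType) (X Y : hilbertType R).
Local Notation XY := (hprod X Y).

HB.instance Definition _ := GRing.Lmodule.copy XY (X * Y)%type.

Definition hprod_inner (p q : XY) : R := inner p.1 q.1 + inner p.2 q.2.

Let hprod_inner_bilinear : bilinear_for *%R (@idfun R \; *%R) hprod_inner.
Proof.
split=> [q a p p'|p a q q']; rewrite /hprod_inner /=.
  by rewrite !linearPl /= mulrDr addrACA.
by rewrite !linearPr /= mulrDr addrACA.
Qed.

HB.instance Definition _ :=
  bilinear_isBilinear.Build R XY XY R *%R (@idfun R \; *%R) hprod_inner
    hprod_inner_bilinear.

Let hprod_innerC (p q : XY) :
  hprod_inner p q = (-1) ^+ false * @idfun R (hprod_inner q p).
Proof.
by rewrite /hprod_inner /= expr0 mul1r [in LHS]hermC [X in _ + X]hermC /=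
  !expr0 !mul1r.
Qed.

Let norm2 (p : XY) : R := Num.sqrt (hprod_inner p p).

Let innerE (p : XY) : hprod_inner p p = `|p.1| ^+ 2 + `|p.2| ^+ 2.
Proof. by rewrite /hprod_inner !innerxx. Qed.

Let inner_ge0 (p : XY) : 0 <= hprod_inner p p.
Proof. by rewrite innerE addr_ge0 ?sqr_ge0. Qed.

Let norm2_sqr (p : XY) : norm2 p ^+ 2 = `|p.1| ^+ 2 + `|p.2| ^+ 2.
Proof. by rewrite sqr_sqrtr ?inner_ge0 // innerE. Qed.

Let norm2_eq0 (p : XY) : norm2 p = 0 -> p = 0.
Proof.
move=> p0; have := norm2_sqr p; rewrite p0 expr0n /= => /esym/eqP.
rewrite paddr_eq0 ?sqr_ge0 // !sqrf_eq0 !normr_eq0.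
by case: p {p0} => x y /= /andP[/eqP-> /eqP->].
Qed.

Let norm2Z (l : R) (p : XY) : norm2 (l *: p) = `|l| * norm2 p.
Proof.
rewrite /norm2 !innerE /= !normrZ !exprMn -mulrDr.
by rewrite sqrtrM ?sqr_ge0 // sqrtr_sqr normr_id.
Qed.

Let norm2D (p q : XY) : norm2 (p + q) <= norm2 p + norm2 q.
Proof.
have p0 : 0 <= norm2 p := sqrtr_ge0 _.
have q0 : 0 <= norm2 q := sqrtr_ge0 _.
rewrite -(ler_pXn2r (n := 2)) ?nnegrE ?addr_ge0 ?sqrtr_ge0 //.
have [Ep Eq] := (norm2_sqr p, norm2_sqr q).
have le1 := ler_normD p.1 q.1; have le2 := ler_normD p.2 q.2.
have := normr_ge0 (p.1 + q.1); have := normr_ge0 (p.2 + q.2).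
rewrite norm2_sqr /=.
have := normr_ge0 p.1; have := normr_ge0 q.1.
have := normr_ge0 p.2; have := normr_ge0 q.2.
move: Ep Eq le1 le2.
move: (`|p.1|) (`|p.2|) (`|q.1|) (`|q.2|) (norm2 p) (norm2 q) p0 q0.
move: (`|p.1 + q.1|) (`|p.2 + q.2|) => e f a b c d s t s0 t0.
move=> Es Et le1 le2 d0 b0 c0 a0 f0 e0.
have CS : a * c + b * d <= s * t.
  rewrite -(ler_pXn2r (n := 2)) ?nnegrE ?addr_ge0 ?mulr_ge0 //.
  rewrite [leRHS]exprMn Es Et -subr_ge0.
  suff -> : (a ^+ 2 + b ^+ 2) * (c ^+ 2 + d ^+ 2) - (a * c + b * d) ^+ 2
    = (a * d - b * c) ^+ 2 by exact: sqr_ge0.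
  by ring.
have {}le1 : e ^+ 2 <= (a + c) ^+ 2 by rewrite ler_pXn2r ?nnegrE ?addr_ge0.
have {}le2 : f ^+ 2 <= (b + d) ^+ 2 by rewrite ler_pXn2r ?nnegrE ?addr_ge0.
apply: (le_trans (lerD le1 le2)).
by rewrite !sqrrD Es Et; lra.
Qed.

HB.instance Definition _ := @Lmodule_isNormed.Build R XY norm2
  norm2D norm2Z norm2_eq0.

Let norm_fst_le (p : XY) : `|p.1| <= `|p|.
Proof.
rewrite -(ler_pXn2r (n := 2)) ?nnegrE ?normr_ge0 //.
by rewrite [leRHS]norm2_sqr lerDl sqr_ge0.
Qed.

Let norm_snd_le (p : XY) : `|p.2| <= `|p|.
Proof.
rewrite -(ler_pXn2r (n := 2)) ?nnegrE ?normr_ge0 //.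
by rewrite [leRHS]norm2_sqr lerDr sqr_ge0.
Qed.

Let norm_le (p : XY) : `|p| <= `|p.1| + `|p.2|.
Proof.
rewrite -(ler_pXn2r (n := 2)) ?nnegrE ?addr_ge0 //.
rewrite [leLHS]norm2_sqr sqrrD.
have := mulr_ge0 (normr_ge0 p.1) (normr_ge0 p.2); lra.
Qed.

Let hprod_complete (F : set_system XY) :
  ProperFilter F -> cauchy F -> cvg F.
Proof.
move=> FF /cauchy_ballP Fc.
have cvg1 : cvg ((fun p : XY => p.1) @ F).
  apply: cauchy_cvg; apply/cauchy_ballP => e e0.
  have := Fc _ e0; rewrite /prop_near2 => -[[A B] /= [FA FB] AB].
  exists ((fun p : XY => p.1) @` A, (fun p : XY => p.1) @` B) => /=.
    split; [apply: filterS FA|apply: filterS FB] => p Ap; by exists p.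
  move=> [_ _] /= [[p Ap <-] [q Bq <-]].
  have /= := AB (p, q) (conj Ap Bq).
  by rewrite -!ball_normE /=; exact/le_lt_trans/(norm_fst_le (p - q)).
have cvg2 : cvg ((fun p : XY => p.2) @ F).
  apply: cauchy_cvg; apply/cauchy_ballP => e e0.
  have := Fc _ e0; rewrite /prop_near2 => -[[A B] /= [FA FB] AB].
  exists ((fun p : XY => p.2) @` A, (fun p : XY => p.2) @` B) => /=.
    split; [apply: filterS FA|apply: filterS FB] => p Ap; by exists p.
  move=> [_ _] /= [[p Ap <-] [q Bq <-]].
  have /= := AB (p, q) (conj Ap Bq).
  by rewrite -!ball_normE /=; exact/le_lt_trans/(norm_snd_le (p - q)).
have /cvg_ex[x Fx] := cvg1; have /cvg_ex[y Fy] := cvg2.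
apply/cvg_ex; exists ((x, y) : XY).
apply/cvgrPdist_lt => e e0; have e2 : 0 < e / 2 by rewrite divr_gt0.
move/cvgrPdist_lt : Fx => /(_ _ e2) Fx; move/cvgrPdist_lt : Fy => /(_ _ e2) Fy.
near=> p; apply: (le_lt_trans (norm_le _)); rewrite [e]splitr /=.
by apply: ltrD; [near: p; exact: Fx|near: p; exact: Fy].
Unshelve. all: by end_near. Qed.

HB.instance Definition _ := Uniform_isComplete.Build XY hprod_complete.

HB.instance Definition _ := isHermitianSesquilinear.Build R XY false (@idfun R)
  hprod_inner hprod_innerC.

Let hprod_inner_gt0 (p : XY) : p != 0 -> 0 < hprod_inner p p.
Proof.
move=> p0; rewrite lt_def inner_ge0 andbT; apply: contra p0 => /eqP p0.
by apply/eqP/norm2_eq0; rewrite /norm2 p0 sqrtr0.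
Qed.

HB.instance Definition _ := isDotProduct.Build R XY hprod_inner hprod_inner_gt0.

Let hprod_innerxx (p : XY) : hprod_inner p p = `|p| ^+ 2.
Proof. by rewrite [RHS]norm2_sqr innerE. Qed.

HB.instance Definition _ :=
  CompleteNormedModule_isHilbert.Build R XY hprod_innerxx.

End HilbertProduct.

Definition finite_dimensional (K : fieldType) (V : lmodType K) :=
  exists n (e : 'I_n -> V), forall v, exists c : 'I_n -> K,
    v = \sum_(i < n) c i *: e i.

Definition proximinal (K : numFieldType) (V : normedModType K) (S : set V) :=
  forall x, exists2 s, S s & forall t, S t -> `|x - s| <= `|x - t|.

Definition dual (K : numFieldType) (E : normedModType K) :=
  {f : {scalar E} | continuous (f : E -> K)}.

(* E with its weak topology, the coarsest one making every continuous linear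
   functional on E continuous. *)
Definition weak_space (K : numFieldType) (E : normedModType K) : Type :=
  sup_topology (fun f : dual E =>
    Topological.on (initial_topology (sval f : E -> K))).

HB.instance Definition _ (K : numFieldType) (E : normedModType K) :=
  Topological.copy (weak_space E) (sup_topology (fun f : dual E =>
    Topological.on (initial_topology (sval f : E -> K)))).

Definition weakly_closed (K : numFieldType) (E : normedModType K)
    (S : set E) :=
  @closed (weak_space E) S.

Definition weak_closure (K : numFieldType) (E : normedModType K)
    (S : set E) : set E :=
  @closure (weak_space E) S.

Definition weakly_seq_closed (K : numFieldType) (E : normedModType K)
    (S : set E) :=
  forall (u : nat -> weak_space E) (l : weak_space E),
    (forall n, S (u n)) -> u @ \oo --> l -> S l.

Definition weak_seq_closure (K : numFieldType) (E : normedModType K)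
    (S : set E) : set E :=
  smallest (@weakly_seq_closed K E) S.

(* Main.v *)
(* Since 4<x, y> = |x + y|^2 - |x - y|^2, after the rotation
   (a, b) = (x + y, x - y) the set C becomes {|a| = |b|}, which is closed.  A
   nearest point to (a, b) is obtained by moving a and b radially to the common
   norm (|a| + |b|) / 2, because the distance from a to any vector of norm w is
   at least | |a| - w |.

   If X is infinite-dimensional, Gram-Schmidt yields an orthonormal sequence
   (e_n) orthogonal to both x and y.  With c = <x, y>, the pairs
   (x + e_n, y - c e_n) lie in C, and they converge weakly to (x, y) because a
   continuous functional tends to 0 along a bounded orthogonal sequence.  So
   every point is the weak limit of a sequence of C. *)
Require Import Defs.
From mathcomp Require Import all_boot all_order all_algebra sesquilinear.
From mathcomp Require Import all_classical all_reals all_analysis.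
From mathcomp Require Import ring lra.

Import Order.TTheory GRing.Theory Num.Theory.
Import numFieldNormedType.Exports.

Local Open Scope classical_set_scope.
Local Open Scope ring_scope.

(** * Inner product identities and Gram-Schmidt orthogonalisation *)

Section HilbertSpace.
Context {R : realType} {H : hilbertType R}.
Implicit Types x y z : H.

Lemma innerC x y : inner x y = inner y x.
Proof. by rewrite hermC expr0 mul1r. Qed.

Lemma innerDl x y z : inner (x + y) z = inner x z + inner y z.
Proof. exact: linearDl. Qed.

Lemma innerZl a x y : inner (a *: x) y = a * inner x y.
Proof. exact: linearZl_LR. Qed.

Lemma innerDr x y z : inner x (y + z) = inner x y + inner x z.
Proof. exact: linearDr. Qed.

Lemma innerZr a x y : inner x (a *: y) = a * inner x y.
Proof. exact: linearZr_LR. Qed.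

Lemma innerNl x y : inner (- x) y = - inner x y.
Proof. exact: linearNl. Qed.

Lemma innerNr x y : inner x (- y) = - inner x y.
Proof. exact: linearNr. Qed.

Lemma inner0l x : inner 0 x = 0.
Proof. exact: linear0l. Qed.

Lemma inner0r x : inner x 0 = 0.
Proof. exact: linear0r. Qed.

Lemma inner_suml n (F : 'I_n -> H) x :
  inner (\sum_(i < n) F i) x = \sum_(i < n) inner (F i) x.
Proof. exact: linear_sumlz. Qed.

Lemma sqr_normD x y : `|x + y| ^+ 2 = `|x| ^+ 2 + inner x y *+ 2 + `|y| ^+ 2.
Proof.
by rewrite -!innerxx innerDl !innerDr [inner y x]innerC mulr2n !addrA.
Qed.

Lemma sqr_normB x y : `|x - y| ^+ 2 = `|x| ^+ 2 - inner x y *+ 2 + `|y| ^+ 2.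
Proof. by rewrite sqr_normD normrN innerNr mulNrn. Qed.

Lemma inner_eq0 x y : (inner x y == 0) = (`|x + y| == `|x - y|).
Proof.
rewrite -[RHS](eqrXn2 (n := 2)) // sqr_normD sqr_normB (inj_eq (addIr _)).
rewrite (inj_eq (addrI _)) -subr_eq0 opprK -!mulr2n -mulrnA.
by rewrite mulrn_eq0.
Qed.

(* For [a = 0] every point of the sphere is nearest; [x] is only there to
   guarantee that the sphere is not empty. *)
Lemma sphere_nearest x (a : H) (r : R) : x != 0 -> 0 <= r ->
  exists2 u, `|u| = r & `|a - u| = `| `|a| - r|.
Proof.
move=> x0 r0; have [->|a0] := eqVneq a 0.
  exists ((r / `|x|) *: x); rewrite ?sub0r ?normr0 ?sub0r ?normrN normrZ.
    by rewrite ger0_norm ?divr_ge0 // divfK ?normr_eq0.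
  by rewrite ger0_norm ?divr_ge0 // divfK ?normr_eq0 // ger0_norm.
exists ((r / `|a|) *: a).
  by rewrite normrZ ger0_norm ?divr_ge0 // divfK ?normr_eq0.
rewrite -{1}[a]scale1r -scalerBl normrZ -{2}[`|a|]normr_id -normrM.
by rewrite mulrBl mul1r divfK ?normr_eq0.
Qed.

(** One Gram-Schmidt step per induction step. The induction is over all [x], because its hypothesis
    is applied both to [x] and to the new vector [e n]; linear independence of [e] is not
    assumed. *)
Lemma orthogonal_projection n (e : nat -> H) x : exists c : nat -> R,
  forall j, (j < n)%N -> inner (x - \sum_(i < n) c i *: e i) (e j) = 0.
Proof.
elim: n x => [|n IHn] x; first by exists (fun=> 0).
have [c cP] := IHn x; have [d dP] := IHn (e n).
set p := \sum_(i < n) c i *: e i in cP; set q := \sum_(i < n) d i *: e i in dP.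
(* If [e n] is in the span of the previous vectors, then [k = 0 / 0 = 0],
   which is the right value. *)
pose k := inner (x - p) (e n - q) / inner (e n - q) (e n - q).
have residual : x - \sum_(i < n.+1)
    (if (i < n)%N then c i - k * d i else k) *: e i
    = (x - p) - k *: (e n - q).
  rewrite big_ord_recr /= ltnn.
  under eq_bigr do rewrite ltn_ord scalerBl -scalerA.
  rewrite sumrB -scaler_sumr -/p -/q scalerBr !opprD !opprK addrA.
  by rewrite -!addrA; congr (_ + (_ + _)); rewrite addrC.
exists (fun i => if (i < n)%N then c i - k * d i else k) => j.
rewrite ltnS leq_eqVlt residual innerDl innerNl innerZl => /predU1P[->|jn].
  (* Both residuals [x - p] and [e n - q] are orthogonal to the earlier vectors, hence to [q], so
     pairing them with [e n] is the same as pairing them with [e n - q]. *)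
  have orth y : (forall j, (j < n)%N -> inner y (e j) = 0) -> inner y q = 0.
    move=> y0; rewrite innerC inner_suml big1 // => i _.
    by rewrite innerZl innerC y0 ?mulr0.
  have shift y : (forall j, (j < n)%N -> inner y (e j) = 0) ->
      inner y (e n) = inner y (e n - q).
    by move=> /orth y0; rewrite innerDr innerNr y0 subr0.
  rewrite !shift // /k; have [/eqP|w0] := eqVneq (inner (e n - q) (e n - q)) 0.
    rewrite innerxx sqrf_eq0 normr_eq0 => /eqP->.
    by rewrite !inner0r normr0 expr0n mulr0 subrr.
  by rewrite divfK ?subrr.
by rewrite cP // dP // mulr0 subrr.
Qed.

(** Since [s] cannot span [H], some [x] lies outside its span; the residual of [x] after projection
    is nonzero and can be normalised. *)
Lemma unit_orthogonal : ~ finite_dimensional H -> forall s : seq H,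
  exists2 u : H, `|u| = 1 & forall v, v \in s -> inner u v = 0.
Proof.
move=> infH s; have [[x xP]|nx] := pselect (exists x : H, forall c : nat -> R,
    x - \sum_(i < size s) c i *: nth 0 s i != 0).
  have [c cP] := orthogonal_projection (size s) (nth 0 s) x.
  set w := x - _ in cP; have w0 : w != 0 := xP c.
  exists (`|w|^-1 *: w) => [|v vs].
    by rewrite normrZ normfV normr_id mulVf ?normr_eq0.
  by rewrite innerZl -(nth_index 0 vs) cP ?index_mem ?mulr0.
case: infH; exists (size s), (fun i => nth 0 s i) => x.
apply: contrapT => xs; apply: nx; exists x => c; apply/eqP => xc; apply: xs.
by exists c; apply/eqP; rewrite -subr_eq0 xc.
Qed.

Lemma orthonormal_sequence (s : seq H) : ~ finite_dimensional H ->
  exists e : nat -> H, [/\ forall n, `|e n| = 1,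
    forall n v, v \in s -> inner (e n) v = 0
    & forall m n, (m < n)%N -> inner (e n) (e m) = 0].
Proof.
move=> infH; pose P (t : seq H) (u : H) :=
  `|u| = 1 /\ forall v, v \in t -> inner u v = 0.
have [g gP] : {g & forall t, P t (g t)}.
  by apply: (@choice _ _ P) => t; have [u] := unit_orthogonal infH t; exists u.
(* [L n] lists the first [n] chosen vectors, latest first, followed by [s]; the next vector
   [g (L n)] is orthogonal to all of them. *)
pose L := fix L n := if n is n.+1 then g (L n) :: L n else s.
have LS n d : {subset L n <= L (d + n)%N}.
  by elim: d => // d IHd v /IHd vL; rewrite addSn inE vL orbT.
exists (fun n => g (L n)); split=> [n|n v vs|m n mn].
- by have [] := gP (L n).
- by have [_] := gP (L n); apply; rewrite -[n]addn0; exact: LS.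
- have [_] := gP (L n); apply; rewrite -(subnK mn); apply: LS.
  by rewrite inE eqxx.
Qed.

(** * Continuous functionals and weak convergence *)

Lemma dual_bounded (f : dual H) :
  exists2 M, 0 < M & forall x, `|sval f x| <= M * `|x|.
Proof.
case: f => f fc /=; have /linear_boundedP/pinfty_ex_gt0[M M0 fM] :
  bounded_near f (nbhs (0 : H)) by apply/linear_bounded_continuous.
by exists M.
Qed.

Lemma sqr_norm_sum_orthogonal (u : nat -> H) (a : nat -> R) n :
  (forall i j, (i < j)%N -> inner (u j) (u i) = 0) ->
  `|\sum_(i < n) a i *: u i| ^+ 2 = \sum_(i < n) a i ^+ 2 * `|u i| ^+ 2.
Proof.
move=> u0; elim: n => [|n IHn]; first by rewrite !big_ord0 normr0 expr0n.
rewrite !big_ord_recr /= sqr_normD IHn inner_suml [X in X *+ 2]big1 => [|i _].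
  by rewrite mul0rn addr0 normrZ exprMn real_normK ?num_real.
by rewrite innerZl innerZr innerC u0 ?mulr0.
Qed.

(* Bessel's inequality without the Riesz representation: testing [f] on
   [v = \sum_(i < n) f (u i) *: u i] gives
   [f v = \sum_(i < n) f (u i) ^+ 2 <= M * `|v|], where [`|v| ^+ 2] is at most
   [B ^+ 2 * f v]. *)
Lemma dual_orthogonal_cvg0 (f : dual H) (u : nat -> H) (B : R) :
  (forall n, `|u n| <= B) ->
  (forall i j, (i < j)%N -> inner (u j) (u i) = 0) ->
  (fun n => sval f (u n)) @ \oo --> (0 : R).
Proof.
move=> uB u0; have [M M0 fM] := dual_bounded f.
have B0 : 0 <= B := le_trans (normr_ge0 _) (uB 0%N).
have bessel n : series (fun i => sval f (u i) ^+ 2) n <= M ^+ 2 * B ^+ 2.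
  rewrite /series /= big_mkord; set S := \sum_(i < n) _.
  pose v := \sum_(i < n) sval f (u i) *: u i.
  have fv : sval f v = S.
    by rewrite linear_sum; apply: eq_bigr => i _; rewrite linearZ.
  have vB : `|v| ^+ 2 <= B ^+ 2 * S.
    rewrite (sqr_norm_sum_orthogonal u (fun i => sval f (u i))) // mulr_sumr.
    apply: ler_sum => i _.
    by rewrite mulrC ler_wpM2r ?sqr_ge0 // ler_pXn2r ?nnegrE.
  have S0 : 0 <= S by apply: sumr_ge0 => i _; exact: sqr_ge0.
  (* The estimate obtained is [S ^+ 2 <= M ^+ 2 * B ^+ 2 * S], from which a factor [S] has to be
     cancelled. *)
  have [->|Sn0] := eqVneq S 0; first by rewrite mulr_ge0 ?sqr_ge0.
  have {S0} Sgt0 : 0 < S by rewrite lt_def Sn0.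
  rewrite -(ler_pM2r Sgt0) -mulrA -expr2 -fv.
  have : `|sval f v| ^+ 2 <= (M * `|v|) ^+ 2.
    by rewrite ler_pXn2r ?nnegrE ?mulr_ge0 // ltW.
  rewrite real_normK ?num_real // exprMn => /le_trans; apply.
  by rewrite fv ler_wpM2l ?sqr_ge0.
have /cvg_series_cvg_0 sq0 : cvgn (series (fun i => sval f (u i) ^+ 2)).
  apply: nondecreasing_is_cvgn.
    by apply: nondecreasing_series => n _ _; exact: sqr_ge0.
  by exists (M ^+ 2 * B ^+ 2) => _ [n _ <-].
apply/cvgr0Pnorm_lt => eps eps0; have eps20 : 0 < eps ^+ 2 by rewrite exprn_gt0.
move/cvgr0Pnorm_lt : sq0 => /(_ _ eps20); apply: filterS => n.
by rewrite normrX ltr_pXn2r ?nnegrE // ltW.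
Qed.

End HilbertSpace.

(** Convergence in a supremum of topologies is convergence in each of them, and the open sets of an
    initial topology are preimages of open sets. *)
Lemma cvg_weak (K : numFieldType) (E : normedModType K) (F : set_system E)
    (l : E) : Filter F ->
  (forall f : dual E, sval f x @[x --> F] --> sval f l) ->
  F --> (l : weak_space E).
Proof.
move=> FF Fl; apply/cvg_sup => f A; rewrite nbhsE => -[B [[C oC <-] Cl] BA].
by apply: (filterS BA); apply: (Fl f); exact: open_nbhs_nbhs.
Qed.

(** * Norm and projections of the Hilbert product *)

Section HilbertProduct.
Context {R : realType} {X Y : hilbertType R}.
Implicit Types p q : hprod X Y.

Lemma hprod_innerE p q : inner p q = inner p.1 q.1 + inner p.2 q.2.
Proof. by []. Qed.

Lemma sqr_hprod_norm p : `|p| ^+ 2 = `|p.1| ^+ 2 + `|p.2| ^+ 2.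
Proof. by rewrite -!innerxx. Qed.

Lemma le_norm_fst p : `|p.1| <= `|p|.
Proof.
rewrite -(ler_pXn2r (n := 2)) ?nnegrE ?normr_ge0 //.
by rewrite sqr_hprod_norm lerDl sqr_ge0.
Qed.

Lemma le_norm_snd p : `|p.2| <= `|p|.
Proof.
rewrite -(ler_pXn2r (n := 2)) ?nnegrE ?normr_ge0 //.
by rewrite sqr_hprod_norm lerDr sqr_ge0.
Qed.

Lemma continuous_hprod_fst : continuous (fun p : hprod X Y => p.1).
Proof.
move=> p; apply/(@cvgrPdist_lt _ _ _ (nbhs p)) => eps eps0.
near=> q; apply: le_lt_trans (le_norm_fst (p - q)) _.
by near: q; exact: cvgr_dist_lt.
Unshelve. all: by end_near. Qed.

Lemma continuous_hprod_snd : continuous (fun p : hprod X Y => p.2).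
Proof.
move=> p; apply/(@cvgrPdist_lt _ _ _ (nbhs p)) => eps eps0.
near=> q; apply: le_lt_trans (le_norm_snd (p - q)) _.
by near: q; exact: cvgr_dist_lt.
Unshelve. all: by end_near. Qed.

End HilbertProduct.

(** * Closedness, nearest points and weak limits of orthogonal pairs *)

Section OrthogonalPairs.
Context {R : realType} {X : hilbertType R}.

Definition orthogonal_pairs : set (hprod X X) := [set p | inner p.1 p.2 = 0].

Lemma orthogonal_pairsE :
  orthogonal_pairs = [set p | `|p.1 + p.2| = `|p.1 - p.2|].
Proof.
apply/seteqP; split=> p /eqP pC; apply/eqP; first by rewrite -inner_eq0.
by rewrite inner_eq0.
Qed.

Lemma closed_orthogonal_pairs : closed orthogonal_pairs.
Proof.
have -> : orthogonal_pairs =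
    (fun p : hprod X X => `|p.1 + p.2| - `|p.1 - p.2|) @^-1` [set 0].
  rewrite orthogonal_pairsE; apply/seteqP.
  by split=> p /= => [->|/eqP]; [rewrite subrr|rewrite subr_eq0 => /eqP].
apply: preimage_closed => [p _|]; last exact: closed_eq.
have [fst_cont snd_cont] := (@continuous_hprod_fst _ X X p,
  @continuous_hprod_snd _ X X p).
apply: (@continuousB _ _ _ (fun q : hprod X X => `|q.1 + q.2|)).
  exact: (continuous_comp (continuousD fst_cont snd_cont)
    (@norm_continuous _ _ _)).
exact: (continuous_comp (continuousB fst_cont snd_cont)
  (@norm_continuous _ _ _)).
Qed.

(** The rotation to sum and difference only rescales the norm, so distances can be compared in the
    rotated coordinates. *)
Lemma sqr_hprod_norm_parallelogram (p : hprod X X) :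
  `|p| ^+ 2 = (`|p.1 + p.2| ^+ 2 + `|p.1 - p.2| ^+ 2) / 2.
Proof. by rewrite sqr_hprod_norm sqr_normD sqr_normB; field. Qed.

Lemma proximinal_orthogonal_pairs : proximinal orthogonal_pairs.
Proof.
(* A point outside the set has a nonzero first component, which is the nonzero vector that
   [sphere_nearest] asks for. *)
move=> p; have [pC|pC] := pselect (orthogonal_pairs p).
  by exists p => // t _; rewrite subrr normr0.
have p1_neq0 : p.1 != 0.
  by apply/eqP => p1; apply: pC; rewrite /orthogonal_pairs /= p1 inner0l.
pose a := p.1 + p.2; pose b := p.1 - p.2; pose r := (`|a| + `|b|) / 2.
have r0 : 0 <= r by rewrite divr_ge0 ?addr_ge0.
have [u ur au] := sphere_nearest _ a _ p1_neq0 r0.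
have [v vr bv] := sphere_nearest _ b _ p1_neq0 r0.
(* The pair whose sum is [u] and whose difference is [v]. *)
pose s : hprod X X := (2^-1 *: (u + v), 2^-1 *: (u - v)).
have half (x : X) : 2^-1 *: (x + x) = x.
  by rewrite -mulr2n -[x *+ 2]scaler_nat scalerA mulVf ?scale1r ?pnatr_eq0.
have s_sum : s.1 + s.2 = u by rewrite /= -scalerDr addrACA subrr addr0 half.
have s_diff : s.1 - s.2 = v.
  by rewrite /= -scalerBr opprD opprK addrACA subrr add0r half.
exists s; first by rewrite orthogonal_pairsE /= s_sum s_diff ur vr.
move=> t; rewrite orthogonal_pairsE /= => tC.
rewrite -(ler_pXn2r (n := 2)) ?nnegrE ?normr_ge0 //.
rewrite !sqr_hprod_norm_parallelogram ler_pM2r ?invr_gt0 //.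
have sumE q : (p - q).1 + (p - q).2 = a - (q.1 + q.2).
  by rewrite /= addrACA -opprD.
have diffE q : (p - q).1 - (p - q).2 = b - (q.1 - q.2).
  by rewrite /= !opprD !opprK addrACA.
rewrite !sumE !diffE s_sum s_diff au bv !real_normK ?num_real //.
have ge_dist (x y : X) : (`|x| - `|y|) ^+ 2 <= `|x - y| ^+ 2.
  rewrite -[leLHS]real_normK ?num_real // ler_pXn2r ?nnegrE //.
  exact: ler_dist_dist.
have := ge_dist a (t.1 + t.2); have := ge_dist b (t.1 - t.2).
rewrite -tC; move: (`|t.1 + t.2|) => w; rewrite /r.
move=> le1 le2; apply: le_trans (lerD le2 le1).
(* The sum of the squares of [|a| - w] and [|b| - w] exceeds its value at [w = r] by exactly half of
   this square. *)
have := sqr_ge0 (`|a| + `|b| - w *+ 2); lra.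
Qed.

Lemma weak_limit_orthogonal_pairs : ~ finite_dimensional X ->
  forall p : hprod X X, exists2 u : nat -> hprod X X,
    forall n, orthogonal_pairs (u n)
    & u @ \oo --> (p : weak_space (hprod X X)).
Proof.
move=> infX p; pose c := inner p.1 p.2.
have [e [e1 ep ee]] := orthonormal_sequence [:: p.1; p.2] infX.
have [ep1 ep2] : (forall n, inner (e n) p.1 = 0) /\
    (forall n, inner (e n) p.2 = 0).
  by split=> n; apply: ep; rewrite !inE eqxx ?orbT.
pose w n : hprod X X := (e n, - c *: e n).
have uE n : inner (p + w n).1 (p + w n).2 = 0.
  rewrite /= innerDl !innerDr !innerZr ep2 innerxx e1 expr1n.
  rewrite [inner _ (e n)]innerC ep1.
  by rewrite -/c mulr0 addr0 add0r mulr1 subrr.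
exists (fun n => p + w n); first exact: uE.
apply: cvg_weak => f.
suff : (fun n => sval f p + sval f (w n)) @ \oo --> sval f p.
  by under eq_fun do rewrite -linearD.
rewrite -[X in _ --> X]addr0; apply: cvgD; first exact: cvg_cst.
apply: (@dual_orthogonal_cvg0 _ _ f w (1 + `|c|)) => [n|i j ij].
  (* The squared norm of [w n] is [1 + c ^+ 2], at most the square of [1 + |c|]. *)
  rewrite -(ler_pXn2r (n := 2)) ?nnegrE ?addr_ge0 //.
  rewrite sqr_hprod_norm /= normrZ normrN e1 mulr1 expr1n sqrrD expr1n mul1r.
  by rewrite lerD2r lerDl mulrn_wge0.
by rewrite hprod_innerE /= innerZl innerZr ee // !mulr0 addr0.
Qed.

End OrthogonalPairs.

Theorem lemma1p2 (R : realType) (X : hilbertType R) :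
  let C : set (hprod X X) := [set p : hprod X X | inner p.1 p.2 = 0] in
  [/\ closed C,
      finite_dimensional X -> proximinal C
    & ~ finite_dimensional X ->
      [/\ ~ weakly_closed C,
          ~ weakly_seq_closed C,
          weak_closure C = setT
        & weak_seq_closure C = setT]].
Proof.
split=> [|_|infX].
- exact: closed_orthogonal_pairs.
- exact: proximinal_orthogonal_pairs.
have dense := weak_limit_orthogonal_pairs infX.
have C_neqT : orthogonal_pairs <> setT :> set (hprod X X).
  (* The empty list merely yields a unit vector [x], and [(x, x)] is not an orthogonal pair. *)
  have [x x1 _] := unit_orthogonal infX [::].
  move=> CT; have : orthogonal_pairs ((x, x) : hprod X X) by rewrite CT.
  rewrite /orthogonal_pairs /= innerxx x1 expr1n => /eqP.
  by rewrite oner_eq0.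
have seq_closedT (D : set (hprod X X)) :
    orthogonal_pairs `<=` D -> weakly_seq_closed D -> D = setT.
  move=> CD Dcl; apply/seteqP; split=> // p _; have [u uC up] := dense p.
  by apply: (Dcl u p _ up) => n; exact/CD.
(* The weak closure is weakly closed, hence closed under weak limits of sequences, so [seq_closedT]
   applies to it. *)
have closureT : weak_closure orthogonal_pairs = setT :> set (hprod X X).
  apply: seq_closedT; first exact: (@subset_closure (weak_space (hprod X X))).
  move=> u l uC; apply: (@closed_cvg _ (weak_space (hprod X X))).
    exact: closed_closure.
  exact: nearW.
split.
- by move=> /closure_id CC; apply: C_neqT; exact: etrans CC closureT.
- by move=> /(seq_closedT _ (fun _ => id)).
- exact: closureT.
- apply/seteqP; split=> // p _ D [Dcl CD].
  by rewrite (seq_closedT D CD Dcl).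
Qed.
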